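(* Let $q=p^h$ with $p$ prime and $h>1$, and let $n\geq 2$. Let $v\in\mathbb{F}_p^{\theta_n}$ be the incidence vector of a small linear blocking set of $PG(n,q)$ that is not a hyperplane. Then $v\notin C(PG(n,q))$.
   Context: $C(PG(n,q))$ is the $\mathbb{F}_p$-span of the incidence vectors of the hyperplanes of $PG(n,q)$, with coordinates indexed by the $\theta_n=(q^{n+1}-1)/(q-1)$ points. Field reduction: points of $PG(n,q)$ correspond to the elements of the Desarguesian $(h-1)$-spread $\mathcal{D}$ of $PG(h(n+1)-1,p)$, obtained by viewing each $1$-dimensional $\mathbb{F}_q$-subspace of $\mathbb{F}_q^{n+1}$ as an $h$-dimensional $\mathbb{F}_p$-subspace of $\mathbb{F}_p^{h(n+1)}$. For a subspace $U$ of $PG(h(n+1)-1,p)$, $\mathcal{B}(U)$ is the set of spread elements meeting $U$, viewed as a point set of $PG(n,q)$. A small linear blocking set is $\mathcal{B}(U)$ with $\dim U=h(n-1)$. *)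

(* Defs.v *)
From HB Require Import structures.
From mathcomp Require Import all_boot all_order all_algebra all_field.
Unset Printing Implicit Defensive.
Import GRing.Theory.
Local Open Scope ring_scope.

(* PG(n,q) with q = #|F|: subspaces of F^(n+1) = 'rV[F]_(n.+1) are represented
   by their canonical matrices <<A>>%MS (mxalgebra). *)

Definition pg_point {n : nat} {F : finFieldType} (A : 'M[F]_(n.+1)) : bool :=
  (\rank A == 1)%N && (<<A>>%MS == A).

Definition pg_hyperplane {n : nat} {F : finFieldType} (A : 'M[F]_(n.+1)) : bool :=
  (\rank A == n)%N && (<<A>>%MS == A).

Definition pg_incident {n : nat} {F : finFieldType} (P H : 'M[F]_(n.+1)) : bool :=
  (P <= H)%MS.

Definition in_code_PG (p : nat) {n : nat} {F : finFieldType}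
    (v : 'M[F]_(n.+1) -> 'F_p) : Prop :=
  exists a : 'M[F]_(n.+1) -> 'F_p,
    forall P, pg_point P ->
      v P = \sum_(H : 'M[F]_(n.+1) | pg_hyperplane H) a H * (pg_incident P H)%:R.

(* Field reduction.  When char F = p, F^(n+1) is an F_p-vector space, the
   scalar k : 'F_p acting as (k : nat)%:R in F.  An F_p-linear combination of
   a family b of vectors: *)
Definition Fp_comb (p : nat) {n d : nat} {F : finFieldType}
    (b : 'I_d -> 'rV[F]_(n.+1)) (c : 'I_d -> 'F_p) : 'rV[F]_(n.+1) :=
  \sum_(i < d) (nat_of_ord (c i))%:R *: b i.

Definition Fp_independent (p : nat) {n d : nat} {F : finFieldType}
    (b : 'I_d -> 'rV[F]_(n.+1)) : Prop :=
  forall c : 'I_d -> 'F_p, Fp_comb p b c = 0 -> forall i, c i = 0.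

(* B(U) for U the F_p-span of b: the points P of PG(n,q) (i.e. elements of the
   Desarguesian spread) meeting U nontrivially. *)
Definition B_of (p : nat) {n d : nat} {F : finFieldType}
    (b : 'I_d -> 'rV[F]_(n.+1)) (P : 'M[F]_(n.+1)) : bool :=
  [exists c : {ffun 'I_d -> 'F_p}, (Fp_comb p b c != 0) && (Fp_comb p b c <= P)%MS].

Definition incidence_vector (p : nat) {n : nat} {F : finFieldType}
    (S : 'M[F]_(n.+1) -> bool) : 'M[F]_(n.+1) -> 'F_p :=
  fun P => (S P)%:R.

Definition is_hyperplane_set {n : nat} {F : finFieldType}
    (S : 'M[F]_(n.+1) -> bool) : Prop :=
  exists H, pg_hyperplane H /\ forall P, pg_point P -> S P = pg_incident P H.

(* Main.v *)
(* Let U be the F_p-subspace, q = |F|, and choose o <> 0 in U whose point has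
   the least weight J, the number of c with c o in U. For s off the line F o, let
   K_s be the group of scalars l with l s in U + F o, let A_s = |K_s| - 1, and
   choose w with A = A_w > 0 least.

   If the incidence vector of B(U) lies in the code, then for e <= q - 2 the
   moment g(s), the sum of c^e over the c with <s + c o> in B(U), is a linear
   combination of e-th powers of linear forms in s: a hyperplane off o meets
   s + F o in one vector depending linearly on s, and a hyperplane through o
   contributes a full power sum over F. For s = w there are between 1 and
   J A / (J - 1) <= 2 A such c, so by Vandermonde some g with e < 2 A is nonzero
   at w.

   By Schwartz-Zippel that g is nonzero on at least q^n (q - e) vectors, but it
   vanishes at s off F o unless A_s >= A, which double counting allows for at most
   q (q - 1) (q^(n-1) - 1) / A vectors s. As (A - 1)(q - 1 - 2 A) >= 0 this is
   impossible unless K_w = F. In that case U + F o is a proper F-subspace, U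
   lies in a hyperplane, and B(U) is that hyperplane. *)
Require Import Defs.
From HB Require Import structures.
From mathcomp Require Import all_boot all_order all_algebra all_field.
From mathcomp Require Import zify.
Set Implicit Arguments.
Unset Strict Implicit.
Import GRing.Theory.

(** * Power sums over a finite field and nonzeros of sums of powers of linear forms *)

Section FiniteFieldSums.
Local Open Scope ring_scope.
Variable F : finFieldType.

(** Multiplication by some [g] with [g ^+ e != 1] permutes F and scales the sum. For [e = 0],
    translation by 1 shows that the sum of ones vanishes. *)
Lemma sum_expf_eq0 (e : nat) : (e < #|F|.-1)%N -> \sum_(c : F) c ^+ e = 0.
Proof.
case: e => [_|e lt_e].
  have /eqP : \sum_(c : F) (c + 1) = \sum_(c : F) c.
    by rewrite [RHS](reindex_inj (addIr 1)).
  by rewrite big_split /= -subr_eq0 addrAC subrr add0r => /eqP.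
have [g g0 ge] : exists2 g : F, g != 0 & g ^+ e.+1 != 1.
  apply/exists_inP; rewrite -[X in is_true X]negbK negb_exists_in; apply/negP.
  move/forall_inP=> all1.
  have sz : size ('X^(e.+1) - 1%:P : {poly F}) = e.+2 by rewrite size_XnsubC.
  have nz : ('X^(e.+1) - 1%:P : {poly F}) != 0 by rewrite -size_poly_eq0 sz.
  have rts : all (root ('X^(e.+1) - 1%:P)) (enum [set~ (0 : F)]).
    apply/allP=> x; rewrite mem_enum !inE => /all1; rewrite negbK => /eqP xe.
    by rewrite /root !hornerE xe subrr.
  have := max_poly_roots nz rts (enum_uniq _).
  by rewrite -cardE cardsC1 sz ltnS leqNgt lt_e.
have eqS : \sum_(c : F) c ^+ e.+1 = g ^+ e.+1 * \sum_(c : F) c ^+ e.+1.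
  rewrite {1}(reindex_inj (mulfI g0)) mulr_sumr.
  by apply: eq_bigr => c _; rewrite exprMn.
apply: contraNeq ge => S0; apply/eqP/(mulIf S0).
by rewrite mul1r -eqS.
Qed.

(* Expand the Lagrange polynomial at one point of S that vanishes at the
   others. *)
Lemma power_sum_neq0 (S : {set F}) : S != set0 ->
  exists2 e, (e < #|S|)%N & \sum_(c in S) c ^+ e != 0.
Proof.
case/set0Pn=> c0 Sc0.
pose f := \prod_(c <- enum (S :\ c0)) ('X - c%:P).
have sz : size f = #|S| by rewrite size_prod_XsubC -cardE [RHS](cardsD1 c0) Sc0.
have fS : \sum_(c in S) f.[c] != 0.
  rewrite (bigD1 c0) //= big1 ?addr0 => [|c /andP[Sc cc0]].
    by rewrite -rootE root_prod_XsubC mem_enum !inE eqxx.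
  by apply/eqP; rewrite -rootE root_prod_XsubC mem_enum !inE cc0.
have [e ne0|all0] := pickP (fun e : 'I_#|S| => \sum_(c in S) c ^+ e != 0).
  by exists e.
case/eqP: fS.
under eq_bigr => c _ do rewrite horner_coef sz.
rewrite exchange_big big1 //= => e _.
by rewrite -mulr_sumr (eqP (negbFE (all0 e))) mulr0.
Qed.

(** [B] may be 0, so the degree is only bounded; the coefficient at [e] is what gets summed over the
    forms. *)
Lemma size_coef_exp_linear (A B : F) (e : nat) :
  (size ((A%:P + B *: 'X) ^+ e)%R <= e.+1)%N /\ ((A%:P + B *: 'X) ^+ e)`_e = B ^+ e.
Proof.
elim: e => [|e [IHs IHc]]; first by rewrite !expr0 size_poly1 coef1.
split.
  rewrite exprS (leq_trans (size_polyMleq _ _)) //.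
  have szl : (size (A%:P + B *: 'X)%R <= 2)%N.
    rewrite (leq_trans (size_polyD _ _)) // geq_max.
    rewrite (leq_trans (size_polyC_leq1 _)) //.
    by rewrite (leq_trans (size_scale_leq _ _)) ?size_polyX.
  by lia.
rewrite exprS mulrDl coefD coefCM -scalerAl coefZ coefXM /= IHc.
by rewrite nth_default // mulr0 add0r exprS.
Qed.

(* Schwartz-Zippel for sums of powers of linear forms: on each line with
   direction w the function is a polynomial of degree exactly e. *)
Lemma card_power_form_support (I : finType) (N : nat) (a : I -> F)
    (psi : I -> 'cV[F]_N) (e : nat) (w : 'rV[F]_N)
    (g := fun s : 'rV[F]_N => \sum_i a i * ((s *m psi i) 0 0) ^+ e) :
  g w != 0 ->
  (#|F| ^ N * (#|F| - e) <= #|F| * #|[set s | g s != 0%R]|)%N.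
Proof.
move=> gw.
have line y : (#|F| - e <= \sum_(t : F) (g (y + t *: w)%R != 0%R))%N.
  pose r := \sum_i a i *:
    (((y *m psi i) 0 0)%:P + ((w *m psi i) 0 0) *: 'X) ^+ e.
  have rE t : r.[t] = g (y + t *: w).
    rewrite horner_sum; apply: eq_bigr => i _.
    by rewrite !hornerE mulmxDl -scalemxAl !mxE [t * _]mulrC.
  have re : r`_e = g w.
    rewrite coef_sum; apply: eq_bigr => i _.
    rewrite coefZ.
    by have [_ ->] := size_coef_exp_linear ((y *m psi i) 0 0) ((w *m psi i) 0 0) e.
  have r0 : r != 0 by apply: contraNneq gw => r0; rewrite -re r0 coef0.
  have szr : (size r <= e.+1)%N.
    apply: leq_trans (size_sum _ _ _) _; apply/bigmax_leqP=> i _.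
    rewrite (leq_trans (size_scale_leq _ _)) //.
    by case: (size_coef_exp_linear ((y *m psi i) 0 0) ((w *m psi i) 0 0) e).
  have rts : all (root r) (enum [set t | root r t]).
    by apply/allP=> t; rewrite mem_enum inE.
  have := max_poly_roots r0 rts (enum_uniq _); rewrite -cardE => lt_r.
  have -> : (\sum_(t : F) (g (y + t *: w)%R != 0%R) = #|~: [set t | root r t]|)%N.
    rewrite -sum1_card [RHS]big_mkcond /=; apply: eq_bigr => t _.
    by rewrite !inE rootE rE; case: eqP.
  by rewrite cardsCs setCK leq_sub2l // -ltnS (leq_trans lt_r).
(* For each fixed [t], [y + t *: w] runs over all vectors, so every [s] is counted #|F| times. *)
have -> : (#|F| * #|[set s | g s != 0%R]|
           = \sum_(y : 'rV[F]_N) \sum_(t : F) (g (y + t *: w)%R != 0%R))%N.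
  rewrite exchange_big /= -sum_nat_const; apply: eq_bigr => t _.
  rewrite -sum1_card big_mkcond /= [LHS](reindex_inj (addIr (t *: w))) /=.
  by apply: eq_bigr => y _; rewrite inE; case: eqP.
have -> : (#|F| ^ N = #|{: 'rV[F]_N}|)%N by rewrite card_mx mul1n.
by rewrite -sum_nat_const; apply: leq_sum => y _.
Qed.

End FiniteFieldSums.

(** * Counting in an additive subgroup U modulo the line F o *)

Section AdditiveSets.
Local Open Scope ring_scope.
Variables (F : finFieldType) (N : nat).
Implicit Types (U C : {set 'rV[F]_N}) (o s x : 'rV[F]_N).

Definition weight U x : nat := #|[set c : F | c *: x \in U]|.

(** For nonzero [x], this says that the point spanned by [x] belongs to B(U). *)
Definition meets U x : bool := [exists c : F, (c != 0) && (c *: x \in U)].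

Definition scalar_line o : {set 'rV[F]_N} := [set c *: o | c : F].

(** The group K_s: those [l] for which l s lies in U + F o. *)
Definition scalars_mod U o s : {set F} :=
  [set l : F | [exists m : F, l *: s + m *: o \in U]].

(** To be counted in two ways: by [l], and by the points s + c o with c = m / l. *)
Definition mod_count U o s : nat :=
  (\sum_(l : F | l != 0%R) \sum_(m : F) (l *: s + m *: o \in U)%R)%N.

Lemma card_pred_sum (T : finType) (P : pred T) : (\sum_x P x = #|[set x | P x]|)%N.
Proof.
rewrite -sum1_card [RHS]big_mkcond /=; apply: eq_bigr => x _.
by rewrite inE; case: (P x).
Qed.

Lemma weightZ U (c : F) x : c != 0 -> weight U (c *: x) = weight U x.
Proof.
move=> c0; rewrite /weight -!card_pred_sum [RHS](reindex_inj (mulIf c0)) /=.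
by apply: eq_bigr => d _; rewrite scalerA.
Qed.

Lemma scalar_lineP o s :
  reflect (exists c : F, s = c *: o) (s \in scalar_line o).
Proof.
apply: (iffP imsetP) => [[c _ ->]|[c ->]]; first by exists c.
by exists c.
Qed.

Lemma scalar_line_offset o s c : s \notin scalar_line o -> s + c *: o != 0.
Proof.
apply: contra; rewrite addr_eq0 => /eqP->; apply/scalar_lineP.
by exists (- c); rewrite scaleNr.
Qed.

Lemma card_scalar_line o : (#|scalar_line o| <= #|F|)%N.
Proof. exact: leq_imset_card. Qed.

Lemma card_scalar_lineI U o :
  o != 0 -> #|U :&: scalar_line o| = weight U o.
Proof.
move=> o0; have inj : injective (fun c : F => c *: o).
  move=> c d /eqP; rewrite -subr_eq0 -scalerBl scaler_eq0 (negbTE o0) orbF.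
  by rewrite subr_eq0 => /eqP.
rewrite /weight -(card_imset _ inj); apply: eq_card => x; rewrite inE.
apply/andP/imsetP => [[Ux /scalar_lineP[c xE]]|[c]].
  by exists c; rewrite // inE -xE.
by rewrite inE => Uc ->; split=> //; apply/scalar_lineP; exists c.
Qed.

Variable U : {set 'rV[F]_N}.
Hypothesis zU : zmod_closed U.

Let U0 : 0 \in U. Proof. by case: zU. Qed.

Let UD x y : x \in U -> y \in U -> x + y \in U.
Proof. by case: (GRing.zmod_closedD zU) => _; apply. Qed.

Let UN x : x \in U -> - x \in U.
Proof. exact: (GRing.zmod_closedN zU). Qed.

Let UDl x y : x \in U -> (x + y \in U) = (y \in U).
Proof.
move=> Ux; apply/idP/idP => [Uxy|]; last exact: UD.
by rewrite -[y](addKr x); apply: UD => //; apply: UN.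
Qed.

(** For fixed [l] the solutions [m] are either absent or a coset of the group of scalars taking [o]
    into U. *)
Lemma sum_fiber o s (l : F) :
  (\sum_(m : F) (l *: s + m *: o \in U)%R
    = (l \in scalars_mod U o s) * weight U o)%N.
Proof.
rewrite inE; case: existsP => [[m0 Um0]|noU]; last first.
  by rewrite mul0n big1 // => m _; case Um: (_ \in U) => //; case: noU; exists m.
rewrite mul1n (reindex_inj (addrI m0)) /weight -card_pred_sum /=.
by apply: eq_bigr => m _; rewrite scalerDl addrA UDl.
Qed.

Lemma scalars_mod0 o s : 0 \in scalars_mod U o s.
Proof. by rewrite inE; apply/existsP; exists 0; rewrite !scale0r addr0. Qed.

Lemma mod_countE o s :
  mod_count U o s = (#|scalars_mod U o s|.-1 * weight U o)%N.
Proof.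
rewrite /mod_count (eq_bigr _ (fun l _ => sum_fiber o s l)) -big_distrl /=.
congr (_ * _)%N; rewrite (cardsD1 0) scalars_mod0 /= -sum1_card.
rewrite [LHS]big_mkcond [RHS]big_mkcond /=; apply: eq_bigr => l _.
by rewrite !inE; case: (l != 0) => //=; case: [exists _, _].
Qed.

Lemma sum_nonzero_multiples x :
  (\sum_(l : F | l != 0%R) (l *: x \in U)%R = (weight U x).-1)%N.
Proof.
rewrite /weight (cardsD1 0) inE scale0r U0 /= -sum1_card.
rewrite [LHS]big_mkcond [RHS]big_mkcond /=; apply: eq_bigr => l _.
by rewrite !inE; case: (l != 0) => //=; case: (_ \in U).
Qed.

Lemma mod_count_points o s :
  mod_count U o s = (\sum_(c : F) (weight U (s + c *: o)%R).-1)%N.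
Proof.
under [RHS]eq_bigr => c _ do rewrite -sum_nonzero_multiples.
rewrite exchange_big /=; apply: eq_bigr => l l0.
rewrite (reindex_inj (mulfI l0)) /=; apply: eq_bigr => c _.
by rewrite scalerDr scalerA.
Qed.

(** Each point s + c o of B(U) contributes at least J - 1 nonzero vectors of U to the count. *)
Lemma card_meets_le o s (J : nat) :
    s \notin scalar_line o ->
    (forall x, x \in U -> x != 0 -> (J <= weight U x)%N) ->
  (#|[set c : F | meets U (s + c *: o)]| * J.-1 <= mod_count U o s)%N.
Proof.
move=> so minJ; rewrite mod_count_points -sum_nat_const big_mkcond /=.
apply: leq_sum => c _; rewrite inE; case: ifP => // /existsP[l /andP[l0 Ul]].
have := minJ _ Ul; rewrite scaler_eq0 (negbTE l0) /= scalar_line_offset //.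
by rewrite weightZ // => /(_ isT); lia.
Qed.

(** K_s is an additive subgroup, so if proper it has a disjoint translate of the same size. *)
Lemma scalars_mod_proper o s :
  scalars_mod U o s != setT -> (2 * #|scalars_mod U o s| <= #|F|)%N.
Proof.
set K := scalars_mod U o s => KT.
have KB k l : k \in K -> l \in K -> k - l \in K.
  rewrite !inE => /existsP[m1 U1] /existsP[m2 U2].
  apply/existsP; exists (m1 - m2).
  by rewrite !scalerBl addrACA -opprD UD // UN.
have [z zK] : exists z, z \notin K.
  apply/existsP; rewrite -negb_forall; apply: contraNN KT => /forallP KE.
  by apply/eqP/setP=> z; rewrite in_setT KE.
have dis : [disjoint K & [set z + k | k in K]].
  apply/pred0P=> x; apply/negP=> /= /andP[Kx /imsetP[k Kk xE]].
  by case/negP: zK; rewrite -(addrK k z) -xE KB.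
have /eqP cardU : #|K :|: [set z + k | k in K]| == (#|K| + #|[set (z + k)%R | k in K]|)%N.
  by have [_ ->] := leq_card_setU K [set z + k | k in K].
rewrite mul2n -addnn -[X in (_ + X)%N](card_imset _ (addrI z)) -cardU.
exact: max_card.
Qed.

(** For fixed [l != 0] and [m], the map s -> l s + m o sends C injectively into U minus F o. *)
Lemma sum_mod_count_le o (C : {set 'rV[F]_N}) : o != 0 ->
    {in C, forall s, s \notin scalar_line o} ->
  (\sum_(s in C) mod_count U o s <= #|F|.-1 * (#|F| * (#|U| - weight U o)))%N.
Proof.
move=> o0 Co; rewrite exchange_big /=.
have -> : #|F|.-1 = #|[set~ (0 : F)]| by rewrite cardsC1.
rewrite -sum_nat_const [leqRHS](eq_bigl (fun l : F => l != 0)) => [|l]; last first.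
  by rewrite !inE.
apply: leq_sum => l l0; rewrite exchange_big /= -[#|F|]/#|{: F}| -sum_nat_const.
apply: leq_sum => m _.
have -> : (#|U| - weight U o = #|U :\: scalar_line o|)%N.
  by rewrite cardsD card_scalar_lineI.
have inj : injective (fun s => l *: s + m *: o).
  by move=> s t /addIr /(scalerI l0).
rewrite -big_mkcondr /= sum1dep_card -(card_imset _ inj); apply: subset_leq_card.
apply/subsetP=> x /imsetP[s]; rewrite !inE => /andP[Cs Us] ->; rewrite Us andbT.
apply: contra (Co _ Cs) => /scalar_lineP[c eq_c]; apply/scalar_lineP.
exists (l^-1 * (c - m)); apply: (scalerI l0).
by rewrite scalerA mulVKf // scalerBl -eq_c addrK.
Qed.

End AdditiveSets.

(** * Linear sets whose characteristic function is a combination of hyperplanes *)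

Section LinearSetsInTheCode.
Local Open Scope ring_scope.
Variable F : finFieldType.

Lemma mx11_eq0 (M : 'M[F]_1) : (M == 0) = (M 0 0 == 0).
Proof.
apply/eqP/eqP => [->|M0]; first by rewrite mxE.
by apply/matrixP=> i j; rewrite !ord1 M0 mxE.
Qed.

(** [X] is the row space of the matrix listing its elements, so a nonzero column of the cokernel
    kills it. *)
Lemma proper_subspace_annihilator (N : nat) (X : {set 'rV[F]_N}) :
    submod_closed X -> (#|X| < #|F| ^ N)%N ->
  exists2 phi : 'cV[F]_N, phi != 0 & {in X, forall x, x *m phi = 0}.
Proof.
move=> [X0 XDZ] ltX.
have XD x y : x \in X -> y \in X -> x + y \in X.
  by move=> Xx Xy; rewrite -[x]scale1r XDZ.
have XZ c x : x \in X -> c *: x \in X.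
  by move=> Xx; rewrite -[_ *: _]addr0 XDZ.
pose G := \matrix_(i < #|X|) enum_val i.
have spanG D : D *m G \in X.
  rewrite mulmx_sum_row; apply: (big_ind (fun x => x \in X)) => // i _.
  by rewrite rowK XZ // enum_valP.
have cokerG : cokermx G != 0.
  apply: contraL ltX => /eqP coker0; rewrite -leqNgt.
  have -> : (#|F| ^ N = #|[set: 'rV[F]_N]|)%N by rewrite cardsT card_mx mul1n.
  apply/subset_leq_card/subsetP=> v _.
  have /submxP[D ->] : (v <= G)%MS by rewrite submxE coker0 mulmx0.
  exact: spanG.
have [j colj] : exists j, col j (cokermx G) != 0.
  apply/existsP; apply: contraNT cokerG; rewrite negb_exists => /forallP all0.
  apply/eqP/matrixP=> i j; have := all0 j; rewrite negbK => /eqP/matrixP/(_ i 0).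
  by rewrite !mxE.
exists (col j (cokermx G)) => // x Xx.
rewrite colE mulmxA; suff -> : x *m cokermx G = 0 by rewrite mul0mx.
apply/eqP; rewrite -submxE -(enum_rankK_in Xx Xx).
by rewrite -(rowK (fun i : 'I_#|X| => enum_val i)) row_sub.
Qed.

(* The hypothesis makes U + F o an F-subspace. *)
Lemma saturated_annihilator (n : nat) (U : {set 'rV[F]_n.+1}) (o : 'rV[F]_n.+1) :
    zmod_closed U ->
    {in U, forall u, u \notin scalar_line o ->
       scalars_mod U o u = setT} ->
    (#|U| * #|F| <= weight U o * #|F| ^ n)%N ->
  exists2 phi : 'cV[F]_n.+1, phi != 0 & {in U, forall u, u *m phi = 0}.
Proof.
move=> zU satU cardU.
have [U0 _] := zU; have [_ UD] := GRing.zmod_closedD zU.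
have UN := GRing.zmod_closedN zU.
pose X := [set x : 'rV[F]_n.+1 | [exists m : F, x + m *: o \in U]].
have XP x : reflect (exists m : F, x + m *: o \in U) (x \in X).
  by rewrite inE; apply: existsP.
have X0 : 0 \in X by apply/XP; exists 0; rewrite scale0r addr0.
have XD x y : x \in X -> y \in X -> x + y \in X.
  move=> /XP[c Ux] /XP[d Uy]; apply/XP; exists (c + d).
  by rewrite scalerDl addrACA UD.
have XZ c x : x \in X -> c *: x \in X.
  move=> /XP[m Um]; apply/XP.
  (* If [x] lies on F o, a multiple of [o] cancels [c *: x] and leaves 0, which is in U. *)
  have [/scalar_lineP[d xE]|xo] := boolP (x + m *: o \in scalar_line o).
    exists (c * (m - d)); rewrite -scalerA -scalerDr scalerBl addrA xE subrr.
    by rewrite scaler0.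
  have /setP/(_ c) := satU _ Um xo; rewrite !inE => /existsP[d].
  by rewrite scalerDr scalerA -addrA -scalerDl; exists (c * m + d).
have ltX : (#|X| < #|F| ^ n.+1)%N.
  have w0 : (0 < weight U o)%N.
    by apply/card_gt0P; exists 0; rewrite inE scale0r.
  (* Count pairs [(x, m)] with [x + m *: o] in U: each [x] has [weight U o] of them, and each [m]
     injects [X] into U. *)
  have leX : (#|X| * weight U o <= #|U| * #|F|)%N.
    rewrite -sum_nat_const.
    have fib x : x \in X ->
        weight U o = (\sum_(m : F) (x + m *: o \in U)%R)%N.
      move=> Xx; have := sum_fiber zU o x 1.
      under eq_bigr => m _ do rewrite scale1r.
      move=> ->; have -> : 1 \in scalars_mod U o x; last by rewrite mul1n.
      by case/XP: Xx => m Um; rewrite inE; apply/existsP; exists m; rewrite scale1r.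
    rewrite (eq_bigr _ fib) exchange_big /= mulnC -[#|F|]/#|{: F}| -sum_nat_const.
    apply: leq_sum => m _; rewrite -big_mkcondr /= sum1dep_card.
    rewrite -(card_imset _ (addIr (m *: o))); apply: subset_leq_card.
    by apply/subsetP=> y /imsetP[x]; rewrite !inE => /andP[_ Ux] ->.
  have := leq_trans leX cardU; rewrite mulnC leq_pmul2l // => /leq_ltn_trans; apply.
  by rewrite ltn_exp2l ?finRing_gt1.
have XDZ : submod_closed X by split=> // c x y Xx Xy; rewrite XD ?XZ.
have [phi phi0 Xphi] := proper_subspace_annihilator XDZ ltX.
exists phi => // u Uu; apply: Xphi; apply/XP.
by exists 0; rewrite scale0r addr0.
Qed.

(* Each hyperplane not through o meets the line s + F o in one point, which
   depends linearly on s; a hyperplane through o contributes a multiple of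
   the full power sum, which vanishes. *)
Lemma moment_power_form (n : nat) (I : finType) (a : I -> F)
    (phi : I -> 'cV[F]_n) (f : 'rV[F]_n -> F) (o s : 'rV[F]_n) (e : nat) :
    (forall x, x != 0 -> f x = \sum_i a i * (x *m phi i == 0)%:R) ->
    s \notin scalar_line o -> (e < #|F|.-1)%N ->
  \sum_(c : F) c ^+ e * f (s + c *: o) =
  \sum_i (a i *+ ((o *m phi i) 0 0 != 0)) *
    ((s *m (- ((o *m phi i) 0 0)^-1 *: phi i)) 0 0) ^+ e.
Proof.
move=> fE so lt_e.
under eq_bigr => c _ do rewrite fE ?scalar_line_offset // mulr_sumr.
rewrite exchange_big /=; apply: eq_bigr => i _.
under eq_bigr => c _ do rewrite mulrCA mx11_eq0 mulmxDl -scalemxAl !mxE.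
rewrite -mulr_sumr -scalemxAr !mxE.
set si := \sum_(j < n) _; set oi := \sum_(j < n) _.
have [oi0|oi0] := eqVneq oi 0; last first.
  rewrite /= mulr1n; congr (_ * _).
  rewrite (bigD1 (- oi^-1 * si)) //= big1 ?addr0 => [|c cn].
    by rewrite [_ * si * oi]mulrAC [- _ * oi]mulNr mulVf // mulN1r subrr eqxx mulr1.
  case: eqP => [cE|]; last by rewrite mulr0.
  case/eqP: cn; apply: (mulIf oi0); move/eqP: cE.
  by rewrite addrC addr_eq0 => /eqP->; rewrite mulNr mulNr mulrAC mulVf // mul1r.
rewrite /= mulr0n mul0r; under eq_bigr => c _ do rewrite oi0 mulr0 addr0.
by rewrite -mulr_suml sum_expf_eq0 // mul0r mulr0.
Qed.

Lemma leq_double_of_mul_pred (M A J : nat) :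
  (1 < J)%N -> (M * J.-1 <= A * J)%N -> (M <= 2 * A)%N.
Proof.
move=> J1 MJ; rewrite -(@leq_pmul2r J.-1); last by lia.
by apply: leq_trans MJ _; rewrite mulnAC [leqRHS]mulnC leq_mul2l; lia.
Qed.

(** Here Q = q^(n-1), A = |K_w| - 1, [M] counts the c with w + c o in B(U), [D] is the size of the
    support of g, and [C] counts the s off F o with K_s nontrivial. *)
Lemma linear_set_count_absurd (q p Q J A M e D C : nat) :
    (1 < p)%N -> (p <= J)%N -> (0 < A)%N -> (2 * A.+1 <= q)%N -> (0 < Q)%N ->
    (e < M)%N -> (M <= 2 * A)%N ->
    (q * q * Q * (q - e) <= q * D)%N -> (D <= q + C)%N ->
    (C * (A * J) <= q.-1 * (q * (p * Q - J)))%N -> False.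
Proof.
move=> p1 pJ A0 Aq Q0 eM M2A qD DC CA.
have q0 : (0 < q)%N by lia.
(* As [p <= J], p Q - J is at most J (Q - 1), and J cancels. *)
have CA' : (C * A <= q.-1 * (q * Q.-1))%N.
  rewrite -(@leq_pmul2r J); last by lia.
  rewrite -mulnA (leq_trans CA) // -!mulnA !leq_mul // -subn1 mulnBl mul1n.
  by rewrite leq_sub2r // mulnC leq_mul2l pJ orbT.
have qD' : (q * Q * (q - e) <= q + C)%N.
  by apply: leq_trans DC; rewrite -(leq_pmul2l q0) !mulnA.
(* Equivalent to (A - 1)(q - 1 - 2 A) >= 0. *)
have fac : (q.-1 <= A * (q.+1 - 2 * A))%N.
  have [r ->] : exists r, q = (2 * A.+1 + r)%N by exists (q - 2 * A.+1)%N; lia.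
  have -> : ((2 * A.+1 + r).+1 - 2 * A = r + 3)%N by lia.
  have [B ->] : exists B, A = B.+1 by exists A.-1; lia.
  rewrite mulSn mulnDr; lia.
have [R QE] : exists R, Q = R.+1 by exists Q.-1; lia.
have h : (q * Q * q.-1 <= A * q + q.-1 * (q * Q.-1))%N.
  apply: leq_trans (_ : A * (q + C) <= _)%N; last first.
    by rewrite mulnDr leq_add2l mulnC.
  apply: leq_trans (leq_mul (leqnn A) qD'); rewrite mulnCA leq_mul //.
  by apply: leq_trans fac _; rewrite leq_mul //; lia.
(* Hence q - 1 <= A, against 2 (A + 1) <= q. *)
have : (q * q.-1 <= q * A)%N.
  move: h; rewrite QE /= mulnS mulnDl mulnCA mulnA; lia.
by rewrite leq_pmul2l //; lia.
Qed.

Lemma linear_set_in_code_annihilator (p n : nat) (U : {set 'rV[F]_n.+1})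
    (I : finType) (a : I -> F) (phi : I -> 'cV[F]_n.+1) :
    (1 < n)%N -> (1 < p)%N -> zmod_closed U ->
    #|U| = (p * #|F| ^ n.-1)%N ->
    (forall x, x \in U -> x != 0 -> (p <= weight U x)%N) ->
    (forall x, x != 0 ->
       (meets U x)%:R = \sum_i a i * (x *m phi i == 0)%:R) ->
  exists2 psi : 'cV[F]_n.+1, psi != 0 & {in U, forall u, u *m psi = 0}.
Proof.
case: n U phi => [|n] // U phi n1 p1 zU cardU wtU codeU.
(* After the case split the space is F^(n+2), so [Q = q ^ n] is the size of a subspace of
   codimension 2. *)
set q := #|F|; rewrite /= -/q in cardU; set Q := (q ^ n)%N in cardU.
have q0 : (0 < q)%N := ltnW (finRing_gt1 F).
have Q0 : (0 < Q)%N by rewrite expn_gt0 q0.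
have qQ : (q <= Q)%N by rewrite -[leqLHS]expn1 leq_pexp2l.
have [o' /andP[Uo' o'0]] : exists x, (x \in U) && (x != 0).
  apply/existsP; apply: contraT; rewrite negb_exists => /forallP all0.
  have : (#|U| <= #|[set 0%R : 'rV[F]_n.+2]|)%N.
    apply/subset_leq_card/subsetP=> x Ux; rewrite inE.
    by have := all0 x; rewrite Ux negbK.
  by rewrite cards1 cardU leqNgt (leq_trans p1) // leq_pmulr.
have [o /andP[Uo o0] omin] := @arg_minnP _ o'
  (fun x => (x \in U) && (x != 0)) (weight U) (introT andP (conj Uo' o'0)).
set J := weight U o in omin.
have pJ : (p <= J)%N by apply: wtU.
pose K := scalars_mod U o; pose O := scalar_line o.
pose out s := (s \notin O) && (1 < #|K s|)%N.
have KgtP s l (m : F) : l != 0 -> l *: s + m *: o \in U -> (1 < #|K s|)%N.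
  move=> l0 Uls; have : [set 0; l] \subset K s.
    rewrite subUset !sub1set scalars_mod0 //= inE.
    by apply/existsP; exists m.
  by move/subset_leq_card; rewrite cards2 eq_sym l0.
have outU u : u \in U -> u \notin O -> out u.
  move=> Uu uO; rewrite /out uO /=; apply: (KgtP u 1 0) => //.
    exact: oner_neq0.
  by rewrite scale1r scale0r addr0.
have [w' out_w'] : exists s, out s.
  have /subsetPn[u Uu uO] : ~~ (U \subset O).
    apply/negP=> /subset_leq_card leU; have := leq_trans leU (card_scalar_line o).
    by rewrite cardU leqNgt (leq_ltn_trans qQ) // ltn_Pmull.
  by exists u; apply: outU.
have [w /andP[wO Kw] wmin] := @arg_minnP _ w' out (fun s => #|K s|) out_w'.
(* If K_w = F, minimality forces K_u = F for every u in U off F o. *)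
have [KwT|KwT] := eqVneq (K w) setT.
  apply: (@saturated_annihilator _ U o zU) => [u Uu uO|].
    apply/eqP; rewrite eqEcard subsetT /=.
    by have := wmin _ (outU _ Uu uO); rewrite KwT.
  by rewrite cardU -/q expnSr mulnA leq_pmul2r // leq_mul2r pJ orbT.
exfalso.
pose S := [set c : F | meets U (w + c *: o)].
have cardS : (#|S| <= 2 * #|K w|.-1)%N.
  apply: (@leq_double_of_mul_pred _ _ J); first exact: leq_trans pJ.
  rewrite -[leqRHS]mod_countE //; apply: card_meets_le => // x Ux x0.
  by apply: omin; rewrite Ux.
(* A nonzero [l] with l w + m o in U puts w + (m / l) o in B(U). *)
have S0 : S != set0.
  have [l] : exists l, l \in K w :\ 0.
    by apply/card_gt0P; move: Kw; rewrite (cardsD1 0) scalars_mod0.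
  rewrite !inE => /andP[l0 /existsP[m Um]]; apply/set0Pn; exists (l^-1 * m).
  rewrite inE; apply/existsP; exists l.
  by rewrite l0 scalerDr scalerA mulVKf.
have [e lt_e mom_e] := power_sum_neq0 S0.
have Kproper : (2 * #|K w| <= q)%N by apply: scalars_mod_proper.
(* e < |S| <= 2 (|K_w| - 1) <= q - 2. *)
have lt_eq : (e < q.-1)%N.
  by lia.
pose psi i := - ((o *m phi i) 0 0)^-1 *: phi i.
pose b i := a i *+ ((o *m phi i) 0 0 != 0).
pose g (s : 'rV[F]_n.+2) := \sum_i b i * ((s *m psi i) 0 0) ^+ e.
have gE s : s \notin O -> g s = \sum_(c | meets U (s + c *: o)) c ^+ e.
  move=> sO; rewrite /g /b /psi.
  rewrite -(@moment_power_form _ I a phi (fun x => (meets U x)%:R)) //.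
  rewrite [RHS]big_mkcond /=.
  by apply: eq_bigr => c _; case: ifP => _; rewrite ?mulr1 ?mulr0.
have gw : g w != 0.
  rewrite gE //; congr (_ != 0): mom_e.
  by apply: eq_bigl => c; rewrite inE.
have supp := card_power_form_support gw.
pose C := [set s | out s].
(* Off F o, a nonzero moment needs some s + c o in B(U), which makes K_s nontrivial. *)
have suppC : (#|[set s | g s != 0%R]| <= q + #|C|)%N.
  apply: leq_trans (leq_add (card_scalar_line o) (leqnn _)).
  apply: leq_trans (leq_card_setU _ _); apply/subset_leq_card/subsetP=> s.
  rewrite !inE; case: (boolP (s \in O)) => //= sO gs.
  have [c] : exists c : F, meets U (s + c *: o).
    apply/existsP; apply: contraNT gs; rewrite negb_exists => /forallP none.
    by rewrite gE // big_pred0 // => c; apply/negbTE.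
  case/existsP=> l /andP[l0]; rewrite scalerDr scalerA => Ul.
  by rewrite /out sO; apply: KgtP l0 Ul.
(* By minimality of [w], each s in [C] contributes at least (|K_w| - 1) J to the double count. *)
have countC : (#|C| * (#|K w|.-1 * J) <= q.-1 * (q * (p * Q - J)))%N.
  have CO : {in C, forall s, s \notin scalar_line o}.
    by move=> s; rewrite inE => /andP[].
  have := @sum_mod_count_le _ _ U o C o0 CO; rewrite cardU; apply: leq_trans.
  rewrite -sum_nat_const; apply: leq_sum => s; rewrite inE => out_s.
  have := wmin s out_s; rewrite mod_countE //.
  by rewrite leq_mul2r -!subn1 => /(leq_sub2r 1) ->; rewrite orbT.
apply: (@linear_set_count_absurd q p Q J #|K w|.-1 #|S| e _ #|C|) suppC countC => //.
- by lia.
- by lia.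
- by move: supp; rewrite !expnS !mulnA.
Qed.

End LinearSetsInTheCode.

(** * Field reduction: from points, hyperplanes and F_p-spans to vectors and linear forms *)

Section FieldReduction.
Local Open Scope ring_scope.
Variables (F : finFieldType) (n : nat).

(** When [H] has rank n its cokernel has rank 1, so one nonzero column of it is a linear form with
    kernel [H]. *)
Definition hyperplane_form (H : 'M[F]_n.+1) : 'cV[F]_n.+1 :=
  (nz_row (cokermx H)^T)^T.

Lemma rank1_submx (m : nat) (A : 'M[F]_(m, n.+1)) (u : 'rV[F]_n.+1) :
  \rank A = 1%N -> u != 0 -> (u <= A)%MS -> (A <= u)%MS.
Proof.
move=> rkA u0 uA; have [_ <-] := mxrank_leqif_sup uA.
by rewrite rank_rV u0 rkA.
Qed.

Lemma hyperplane_formP (H : 'M[F]_n.+1) (x : 'rV[F]_n.+1) :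
  \rank H = n -> (x <= H)%MS = (x *m hyperplane_form H == 0).
Proof.
move=> rkH; rewrite submxE /hyperplane_form.
set M := (cokermx H)^T.
have rkM : \rank M = 1%N by rewrite mxrank_tr mxrank_coker rkH subSnn.
have M0 : M != 0 by rewrite -mxrank_eq0 rkM.
have /submxP[D ME] : (M <= nz_row M)%MS.
  by apply: rank1_submx rkM _ (nz_row_sub M); rewrite nz_row_eq0.
have /submxP[E rE] := nz_row_sub M.
have cE : cokermx H = M^T by rewrite trmxK.
apply/eqP/eqP => [x0|x0].
  by rewrite rE trmx_mul mulmxA -cE x0 mul0mx.
by rewrite cE ME trmx_mul mulmxA x0 mul0mx.
Qed.

Lemma genmx_point (x : 'rV[F]_n.+1) : x != 0 -> pg_point <<x>>%MS.
Proof. by move=> x0; rewrite /pg_point mxrank_gen rank_rV x0 genmx_id eqxx. Qed.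

Variables (p h : nat).
Hypothesis p_prime : prime p.
Hypothesis cardF : #|F| = (p ^ h)%N.

Let charF : p \in [pchar F]. Proof. exact: card_finPcharP cardF p_prime. Qed.

Let p1 : (1 < p)%N. Proof. exact: prime_gt1. Qed.

Definition Fp_emb (x : 'F_p) : F := (nat_of_ord x)%:R.

Lemma Fp_embD x y : Fp_emb (x + y) = Fp_emb x + Fp_emb y.
Proof.
rewrite /Fp_emb -natrD -(GRing.natr_mod_pchar charF (x + y)).
by rewrite -[X in (_ %% X)%N](Fp_cast p_prime).
Qed.

Lemma Fp_emb0 : Fp_emb 0 = 0. Proof. by []. Qed.

Lemma Fp_embN x : Fp_emb (- x) = - Fp_emb x.
Proof. by apply/eqP; rewrite -addr_eq0 -Fp_embD addNr. Qed.

Lemma Fp_emb_bool (c : bool) : Fp_emb c%:R = c%:R.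
Proof. by case: c => //; rewrite /Fp_emb /= Fp_cast // modn_small. Qed.

Lemma Fp_emb_inj : injective Fp_emb.
Proof.
move=> x y /eqP; rewrite -subr_eq0 -Fp_embN -Fp_embD.
rewrite /Fp_emb -(dvdn_pcharf charF) => dvd.
apply/eqP; rewrite -subr_eq0; apply/eqP/val_inj => /=.
have lt : (nat_of_ord (x - y)%R < p)%N.
  by rewrite -[X in (_ < X)%N](Fp_cast p_prime).
by move: dvd; rewrite /dvdn modn_small // => /eqP.
Qed.

Variables (d : nat) (b : 'I_d -> 'rV[F]_n.+1).

Definition Fp_span : {set 'rV[F]_n.+1} :=
  [set Fp_comb p b c | c : {ffun 'I_d -> 'F_p}].

Lemma Fp_combB (c c' : 'I_d -> 'F_p) :
  Fp_comb p b c - Fp_comb p b c' = Fp_comb p b (fun i => c i - c' i).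
Proof.
rewrite /Fp_comb -sumrB; apply: eq_bigr => i _; rewrite -scalerBl.
by rewrite -[in RHS]/(Fp_emb (c i - c' i)) Fp_embD Fp_embN.
Qed.

Lemma Fp_comb_ffun (c : 'I_d -> 'F_p) : Fp_comb p b [ffun i => c i] = Fp_comb p b c.
Proof. by apply: eq_bigr => i _; rewrite ffunE. Qed.

Lemma Fp_span_closed : zmod_closed Fp_span.
Proof.
split=> [|_ _ /imsetP[c _ ->] /imsetP[c' _ ->]].
  apply/imsetP; exists [ffun=> 0] => //; rewrite /Fp_comb big1 // => i _.
  by rewrite ffunE scale0r.
by rewrite Fp_combB -Fp_comb_ffun imset_f.
Qed.

Lemma card_Fp_span : Fp_independent p b -> #|Fp_span| = (p ^ d)%N.
Proof.
move=> indep; rewrite card_imset => [|c c' /eqP].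
  by rewrite card_ffun card_Fp // card_ord.
rewrite -subr_eq0 Fp_combB => /eqP/indep eq_c; apply/ffunP=> i.
by apply/eqP; rewrite -subr_eq0 eq_c.
Qed.

(** The p scalars of the prime field are distinct in F and keep [x] inside the span. *)
Lemma weight_Fp_span x : x \in Fp_span -> (p <= weight Fp_span x)%N.
Proof.
move=> Ux; rewrite -[leqLHS](card_Fp p_prime) -(card_imset _ Fp_emb_inj).
apply/subset_leq_card/subsetP=> _ /imsetP[k _ ->]; rewrite inE /Fp_emb scaler_nat.
have [_ UD] := GRing.zmod_closedD Fp_span_closed.
have [U0 _] := Fp_span_closed.
by elim: (nat_of_ord k) => [|m IHm]; rewrite ?mulr0n // mulrS UD.
Qed.

Lemma B_ofP (P : 'M[F]_n.+1) :
  reflect (exists u, [/\ u \in Fp_span, u != 0 & (u <= P)%MS]) (B_of p b P).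
Proof.
apply: (iffP existsP) => [[c /andP[c0 cP]]|[u [/imsetP[c _ ->] c0 cP]]].
  by exists (Fp_comb p b c); rewrite imset_f.
by exists c; rewrite c0.
Qed.

Lemma B_of_genmx (x : 'rV[F]_n.+1) : x != 0 -> B_of p b <<x>>%MS = meets Fp_span x.
Proof.
move=> x0; apply/B_ofP/existsP => [[u [Uu u0]]|[c /andP[c0 Uc]]].
  rewrite genmxE => /sub_rVP[c uE]; exists c; rewrite -uE Uu andbT.
  by apply: contraNneq u0 => c0; rewrite uE c0 scale0r.
exists (c *: x); rewrite Uc scaler_eq0 negb_or c0 x0 genmxE.
by split=> //; apply: scalemx_sub.
Qed.

(** The coefficients move from F_p into F, where the moments live, and are extended by 0 to matrices
    that are not hyperplanes. *)
Lemma in_code_meets_form : in_code_PG p (incidence_vector p (B_of p b)) ->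
  exists a : 'M[F]_n.+1 -> F, forall x : 'rV[F]_n.+1, x != 0 ->
    (meets Fp_span x)%:R = \sum_H a H * (x *m hyperplane_form H == 0)%:R.
Proof.
case=> a aE; exists (fun H => if pg_hyperplane H then Fp_emb (a H) else 0) => x x0.
have := congr1 Fp_emb (aE _ (genmx_point x0)).
rewrite /incidence_vector Fp_emb_bool B_of_genmx // => ->.
rewrite (big_morph _ Fp_embD Fp_emb0) big_mkcond /=; apply: eq_bigr => H _.
case: ifP => [/andP[/eqP rkH _]|_]; last by rewrite mul0r.
rewrite /pg_incident genmxE hyperplane_formP //.
by case: (_ == 0); rewrite ?mulr1 ?mulr0.
Qed.

(* If U and the line P met only in 0, then U + P + F y, with y off the
   hyperplane, would have more than q^(n+1) elements. *)
Lemma annihilated_B_of (psi : 'cV[F]_n.+1) :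
    (0 < n)%N -> #|Fp_span| = (p * #|F| ^ n.-1)%N -> psi != 0 ->
    {in Fp_span, forall u, u *m psi = 0} ->
  is_hyperplane_set (B_of p b).
Proof.
move=> n0 cardU psi0 Upsi; exists <<kermx psi>>%MS.
have [U0 _] := Fp_span_closed; have UB := Fp_span_closed.2.
split.
  rewrite /pg_hyperplane mxrank_gen genmx_id eqxx andbT mxrank_ker.
  by rewrite -mxrank_tr rank_rV trmx_eq0 psi0 subn1.
move=> P /andP[/eqP rkP _]; rewrite /pg_incident genmxE.
apply/idP/idP => [/B_ofP[u [Uu u0 uP]]|/sub_kermxP Ppsi].
  by apply: submx_trans (rank1_submx rkP u0 uP) _; apply/sub_kermxP/Upsi.
have P0 : P != 0 by rewrite -mxrank_eq0 rkP.
set x := nz_row P.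
have x0 : x != 0 by rewrite nz_row_eq0.
have xP : (x <= P)%MS := nz_row_sub P.
have xpsi : x *m psi = 0.
  by have /submxP[D ->] := xP; rewrite -mulmxA Ppsi mulmx0.
have [y ypsi] : exists y : 'rV[F]_n.+1, (y *m psi) 0 0 != 0.
  have [i psi_i] : exists i, psi i 0 != 0.
    apply/existsP; apply: contraNT psi0; rewrite negb_exists => /forallP all0.
    by apply/eqP/matrixP=> i j; have := all0 i; rewrite ord1 mxE negbK => /eqP.
  by exists (delta_mx 0 i); rewrite -rowE mxE.
apply: contraT => /B_ofP noB.
pose f (t : 'rV[F]_n.+1 * F * F) := t.1.1 + t.1.2 *: x + t.2 *: y.
pose D := setX (setX Fp_span [set: F]) [set: F].
have inj_f : {in D &, injective f}.
  move=> [[u c] e] [[u' c'] e']; rewrite !inE /f /= !andbT => Uu Uu' eq_f.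
  (* [psi] kills U and [x] but not [y], so it reads off the coefficient of [y]. *)
  have ee' : e = e'.
    have := congr1 (fun v => (v *m psi) 0 0) eq_f.
    rewrite !mulmxDl -!scalemxAl xpsi (Upsi u) // (Upsi u') // !scaler0 !add0r !mxE.
    by move: ypsi; rewrite mxE => ypsi /(mulIf ypsi).
  move: eq_f; rewrite ee' => /addIr eq_f.
  have uu' : u - u' = (c' - c) *: x.
    by apply/eqP; rewrite subr_eq scalerBl addrAC eq_sym subr_eq eq_f addrC.
  (* Otherwise [u - u'] would be a nonzero vector of U on [P]. *)
  have u0 : u - u' = 0.
    apply/eqP; apply: contraT => u0; case: noB; exists (u - u'); split=> //.
      exact: UB.
    by rewrite uu' scalemx_sub.
  move/eqP: uu'; rewrite u0 eq_sym scaler_eq0 (negbTE x0) orbF subr_eq0 => /eqP->.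
  by move/eqP: u0; rewrite subr_eq0 => /eqP->.
have := max_card [in f @: D].
rewrite (card_in_imset inj_f) !cardsX !cardsT cardU card_mx mul1n.
have qn0 : (0 < #|F| ^ n.+1)%N by rewrite expn_gt0 cardF expn_gt0 prime_gt0.
have -> : (#|F| ^ n.+1 = #|F| ^ n.-1 * #|F| * #|F|)%N.
  by rewrite -!expnSr prednK.
rewrite -!mulnA leqNgt ltn_Pmull // !mulnA -!expnSr prednK //.
Qed.

End FieldReduction.

(* q = #|F| = p^h; U = F_p-span of b, of vector dimension h(n-1)+1, i.e.
   projective dimension h(n-1) in PG(h(n+1)-1,p); B(U) is a small linear
   blocking set of PG(n,q). *)
Theorem theorem4 (p h n : nat) (F : finFieldType)
  (p_prime : prime p) (h_gt1 : (1 < h)%N) (n_ge2 : (2 <= n)%N)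
  (cardF : #|F| = (p ^ h)%N)
  (b : 'I_(h * (n - 1) + 1) -> 'rV[F]_(n.+1))
  (b_indep : Fp_independent p b)
  (not_hyp : ~ is_hyperplane_set (B_of p b)) :
  ~ in_code_PG p (incidence_vector p (B_of p b)).
Proof.
move=> /(in_code_meets_form p_prime cardF)[a aE]; apply: not_hyp.
(* The vector dimension h (n - 1) + 1 supplies the extra factor p. *)
have cardU : #|Fp_span p b| = (p * #|F| ^ n.-1)%N.
  by rewrite (card_Fp_span p_prime cardF) // addn1 expnS expnM -cardF subn1.
have [|||psi psi0 Upsi] := linear_set_in_code_annihilator n_ge2 _ _ cardU _ aE.
- exact: prime_gt1.
- exact: Fp_span_closed p_prime cardF _ _.
- by move=> x Ux _; apply: weight_Fp_span p_prime cardF _ _ _ Ux.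
by apply: (annihilated_B_of p_prime cardF) cardU psi0 Upsi; apply: ltnW.
Qed.
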